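(* Let $k\ge 2$ be an integer. If $G$ is a $(2k+1)$-connected $(P_{3}\cup kP_{1})$-free graph with toughness $\tau(G)>1$, then $G$ is Hamiltonian-connected.
   Context: All graphs are finite, simple and undirected. The connectivity $\kappa(G)$ of a graph $G$ is the minimum size of a vertex set $S\subseteq V(G)$ such that $G-S$ is disconnected or has only one vertex; $G$ is $m$-connected if $\kappa(G)\ge m$. For a non-complete graph $G$, the toughness is $\tau(G)=\min\{|S|/c(G-S): S\subseteq V(G),\ c(G-S)\ge 2\}$, where $c(G-S)$ denotes the number of connected components of $G-S$; for complete graphs $\tau(G)=\infty$. $P_n$ denotes the path on $n$ vertices, $F_1\cup F_2$ denotes the disjoint union of vertex-disjoint graphs $F_1,F_2$, and $kP_1$ denotes $k$ disjoint copies of $P_1$ (so $P_3\cup kP_1$ is the disjoint union of a path on three vertices and $k$ isolated vertices). A graph $G$ is $F$-free if $G$ does not contain $F$ as an induced subgraph. A Hamiltonian path is a path that traverses every vertex of the graph exactly once. A graph $G$ is Hamiltonian-connected if for every pair of distinct vertices $u,v\in V(G)$ there is a Hamiltonian path of $G$ with endpoints $u$ and $v$. *)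

(* Defs.v *)
From HB Require Import structures.
From mathcomp Require Import all_boot all_order all_algebra.
From mathcomp Require Import constructive_ereal.

Set Implicit Arguments.
Unset Strict Implicit.
Unset Printing Implicit Defensive.

Import Order.TTheory GRing.Theory Num.Theory.

Record sgraph := SGraph {
  vertex :> finType;
  edge : rel vertex;
  edge_sym : symmetric edge;
  edge_irrefl : irreflexive edge }.

Arguments edge {s}.

Definition path_edge n : rel 'I_n := fun i j => (i.+1 == j) || (j.+1 == i).

Lemma path_edge_sym n : symmetric (@path_edge n).
Proof. by move=> i j; rewrite /path_edge orbC. Qed.

Lemma path_edge_irrefl n : irreflexive (@path_edge n).
Proof. by move=> i; rewrite /path_edge orbb; apply/negbTE; rewrite neq_ltn ltnSn orbT. Qed.

Definition path_graph (n : nat) : sgraph :=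
  SGraph (@path_edge_sym n) (@path_edge_irrefl n).

Definition union_edge (F1 F2 : sgraph) : rel (F1 + F2) := fun x y =>
  match x, y with
  | inl a, inl b => edge a b
  | inr a, inr b => edge a b
  | _, _ => false
  end.

Lemma union_edge_sym F1 F2 : symmetric (@union_edge F1 F2).
Proof. by move=> [x|x] [y|y] //=; apply: edge_sym. Qed.

Lemma union_edge_irrefl F1 F2 : irreflexive (@union_edge F1 F2).
Proof. by move=> [x|x] /=; apply: edge_irrefl. Qed.

Definition graph_union (F1 F2 : sgraph) : sgraph :=
  SGraph (@union_edge_sym F1 F2) (@union_edge_irrefl F1 F2).

Definition copies_edge k (F : sgraph) : rel ('I_k * F) := fun x y =>
  (x.1 == y.1) && edge x.2 y.2.

Lemma copies_edge_sym k F : symmetric (@copies_edge k F).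
Proof. by move=> x y; rewrite /copies_edge eq_sym edge_sym. Qed.

Lemma copies_edge_irrefl k F : irreflexive (@copies_edge k F).
Proof. by move=> x; rewrite /copies_edge edge_irrefl andbF. Qed.

Definition graph_copies (k : nat) (F : sgraph) : sgraph :=
  SGraph (@copies_edge_sym k F) (@copies_edge_irrefl k F).

Definition del_edge (G : sgraph) (S : {set G}) : rel {x : G | x \notin S} :=
  fun x y => edge (val x) (val y).

Lemma del_edge_sym (G : sgraph) (S : {set G}) : symmetric (@del_edge G S).
Proof. by move=> x y; apply: edge_sym. Qed.

Lemma del_edge_irrefl (G : sgraph) (S : {set G}) : irreflexive (@del_edge G S).
Proof. by move=> x; apply: edge_irrefl. Qed.

Definition graph_del (G : sgraph) (S : {set G}) : sgraph :=
  SGraph (@del_edge_sym G S) (@del_edge_irrefl G S).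

Definition ncomp (G : sgraph) : nat := n_comp (@edge G) G.

Definition complete (G : sgraph) : bool :=
  [forall x : G, forall y : G, (x != y) ==> edge x y].

Definition separating (G : sgraph) (S : {set G}) : bool :=
  (1 < ncomp (graph_del S)) || (#|graph_del S| == 1).

(* If G has a vertex, deleting all the other vertices is separating, so the
   minimum is over a nonempty family and is less than #|G|; the default value
   #|G| only serves for the null graph, whose connectivity is thus 0. *)
Definition connectivity (G : sgraph) : nat :=
  \big[minn/#|G|]_(S : {set G} | separating S) #|S|.

Definition connected_graph (m : nat) (G : sgraph) : Prop :=
  m <= connectivity G.

(* In a non-complete graph the family is nonempty: delete all vertices but two
   nonadjacent ones. *)
Definition toughness (G : sgraph) : \bar rat :=
  if complete G then +oo%E
  else \big[Order.min/+oo%E]_(S : {set G} | 1 < ncomp (graph_del S))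
         ((#|S|%:R / (ncomp (graph_del S))%:R)%R%:E)%E.

Definition induced_subgraph (F G : sgraph) : Prop :=
  exists f : F -> G, injective f /\ forall x y, edge (f x) (f y) = edge x y.

Definition graph_free (F G : sgraph) : Prop := ~ induced_subgraph F G.

(* u :: p is the sequence of vertices traversed. *)
Definition hamiltonian_path (G : sgraph) (u v : G) (p : seq G) : Prop :=
  [/\ path edge u p, last u p = v, uniq (u :: p) & forall x : G, x \in u :: p].

Definition hamiltonian_connected (G : sgraph) : Prop :=
  forall u v : G, u != v -> exists p : seq G, hamiltonian_path u v p.

(* Main.v *)
Require Import Defs.
From mathcomp Require Import all_boot all_order all_algebra.
From mathcomp Require Import constructive_ereal.
From mathcomp Require Import zify.

(** Let P be a longest u-v path missing a vertex, H a component of G - P, and J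
the set of the successors on P of the neighbors of H.  For h in H the set
h + J is independent of size at least 2k+1, so by (P_3 u kP_1)-freeness any
vertex with two neighbors in it misses at most k-1 of its elements.  Let S be
the set of the vertices with two neighbors in J.  Then G - S has no induced
P_3, hence is a disjoint union of cliques, and any s, t in S either have three
common neighbors in J or have both h as a neighbor.  Rerouting P through H and
through these common neighbors shows that S lies on P and that the successors
of the vertices of S are outside S, pairwise distinct and nonadjacent.  They
lie therefore in distinct components of G - S; adding the component H when v
is in S, this gives |S| components, against toughness greater than 1.
(Below, H, J, h + J and S are [comp], [succs], [probe h] and [heavy].) *)

Set Implicit Arguments.
Unset Strict Implicit.
Unset Printing Implicit Defensive.

Import Order.TTheory GRing.Theory Num.Theory.

(** * Walks as vertex lists, and their consecutive pairs *)

Section Walks.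
Variable G : sgraph.
Implicit Types (x y z a b c d u v p q : G) (s L R E : seq G).

(** The list holds both ends, so walks joined by an edge concatenate, and visited vertices can be
    compared by [perm_eq]. *)
Inductive walk : G -> seq G -> G -> Prop :=
| walk1 x : walk x [:: x] x
| walk_cons x y s z : edge x y -> walk y s z -> walk x (x :: s) z.

Lemma walk_cat a s b c s' d :
  walk a s b -> edge b c -> walk c s' d -> walk a (s ++ s') d.
Proof.
move=> w bc w'; elim: w bc => [x|x y s0 z xy _ IH] bc /=; first exact: walk_cons bc w'.
exact: walk_cons xy (IH bc).
Qed.

Lemma walk_rev a s b : walk a s b -> walk b (rev s) a.
Proof.
elim=> [x|x y s0 z xy _ IH]; first exact: walk1.
rewrite rev_cons -cats1; apply: walk_cat IH _ (walk1 x).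
by rewrite edge_sym.
Qed.

Lemma walk_path a s b : walk a s b -> exists2 s', s = a :: s' & path edge a s' /\ last a s' = b.
Proof.
elim=> [x|x y s0 z xy _ [s' -> [ps ls]]]; first by exists [::].
by exists (y :: s') => //=; rewrite xy.
Qed.

Lemma path_walk a s : path edge a s -> walk a (a :: s) (last a s).
Proof.
elim: s a => [|y s IH] a /=; first by move=> _; apply: walk1.
by case/andP=> ay ps; apply: walk_cons ay (IH _ ps).
Qed.

Lemma walk_start a s b : walk a s b -> a \in s.
Proof.
by case/walk_path=> s' -> _; rewrite mem_head.
Qed.

Lemma walk_neq_nil a s b : walk a s b -> s != [::].
Proof. by case. Qed.

Definition consec s x y := exists s1 s2, s = s1 ++ [:: x, y & s2].

Lemma consec_rev s x y : consec s x y -> consec (rev s) y x.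
Proof.
move=> [s1 [s2 ->]]; exists (rev s2), (rev s1).
by rewrite rev_cat !rev_cons -!cats1 -!catA.
Qed.

Lemma consec_catl s s' x y : consec s x y -> consec (s ++ s') x y.
Proof. by move=> [s1 [s2 ->]]; exists s1, (s2 ++ s'); rewrite -catA. Qed.

Lemma consec_catr s s' x y : consec s' x y -> consec (s ++ s') x y.
Proof. by move=> [s1 [s2 ->]]; exists (s ++ s1), s2; rewrite catA. Qed.

Lemma consec_mem s x y : consec s x y -> x \in s /\ y \in s.
Proof. by move=> [s1 [s2 ->]]; rewrite !mem_cat !inE !eqxx !orbT. Qed.

Lemma consec_cat a s b c s' d x y : walk a s b -> walk c s' d ->
  consec (s ++ s') x y -> [\/ consec s x y, consec s' x y | x = b /\ y = c].
Proof.
move=> w w'; elim: w => {a s b} [z|z z' s z2 zz' ws IH].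
  move=> [[|t s1] [s2 /=]] [].
    by move=> <-; case/walk_path: w' => s3 -> _ [-> _]; apply: Or33.
  by move=> _ ->; apply: Or32; exists s1, s2.
move=> [[|t s1] [s2 /=]] [].
  move=> <-; case/walk_path: ws => s3 -> _ /= [-> _].
  by apply: Or31; exists [::], s3.
move=> _ E; case: IH; first by exists s1, s2.
- by move=> [s3 [s4 ->]]; apply: Or31; exists (z :: s3), s4.
- by move=> ?; apply: Or32.
by move=> ?; apply: Or33.
Qed.

Lemma consec_cut a s b x y : walk a s b -> consec s x y ->
  exists s1 s2, [/\ s = s1 ++ s2, walk a s1 x, walk y s2 b & edge x y].
Proof.
elim=> {a s b} [z|z z' s z2 zz' ws IH].
  by move=> [[|t [|t' s1]] [s2 /=]].
move=> [[|t s1] [s2 /=]] [].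
  move=> <- E; have yz' : y = z' by case: (walk_path ws) => s3; rewrite E => -[].
  by rewrite yz'; exists [:: z], s; split=> //; apply: walk1.
move=> _ E; case: IH; first by exists s1, s2.
move=> s3 [s4 [-> w3 w4 exy]]; exists (z :: s3), s4; split=> //.
exact: walk_cons zz' w3.
Qed.

Lemma consec_uniql s x y x' : uniq s -> consec s x y -> consec s x' y -> x = x'.
Proof.
move=> us [s1 [s2 E1]] [s3 [s4 E2]].
have [u1 u2] : uniq (rcons s1 x ++ y :: s2) /\ uniq (rcons s3 x' ++ y :: s4).
  by rewrite !cat_rcons -E1 -E2.
have i1 : index y s = size (rcons s1 x).
  rewrite E1 -cat_rcons index_cat /= eqxx addn0.
  by move: u1; rewrite cat_uniq /= negb_or => /and3P[_ /andP[/negbTE-> _] _].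
have i2 : index y s = size (rcons s3 x').
  rewrite E2 -cat_rcons index_cat /= eqxx addn0.
  by move: u2; rewrite cat_uniq /= negb_or => /and3P[_ /andP[/negbTE-> _] _].
have /eqP : rcons s1 x ++ y :: s2 = rcons s3 x' ++ y :: s4 by rewrite !cat_rcons -E1.
rewrite eqseq_cat; last by rewrite -i1 -i2.
by case/andP=> /eqP /rcons_inj [].
Qed.

Lemma consec_uniqr s x y y' : uniq s -> consec s x y -> consec s x y' -> y = y'.
Proof.
move=> us c1 c2; apply: (@consec_uniql (rev s) y x y'); first by rewrite rev_uniq.
  exact: consec_rev.
exact: consec_rev.
Qed.

Lemma consec_exists a s b x : walk a s b -> x \in s -> x != b -> exists y, consec s x y.
Proof.
elim=> {a s b} [z|z z' s z2 zz' ws IH]; first by rewrite inE => /eqP->; rewrite eqxx.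
rewrite inE; case: eqP => [-> _ _|_ /= xs xz].
  by case/walk_path: ws => s' -> _; exists z', [::], s'.
case: (IH xs xz) => y [s1 [s2 ->]]; exists y, (z :: s1), s2 => //.
Qed.

Lemma two_cuts a s b x y x' y' : walk a s b ->
  consec s x y -> consec s x' y' -> x != x' ->
  exists s1 s2 s3, s = s1 ++ s2 ++ s3 /\
    ([/\ walk a s1 x, walk y s2 x', walk y' s3 b, edge x y & edge x' y'] \/
     [/\ walk a s1 x', walk y' s2 x, walk y s3 b, edge x y & edge x' y']).
Proof.
move=> w c1 c2 xx'; case: (consec_cut w c1) => t1 [t2 [Es w1 w2 e1]].
rewrite Es in c2; case: (consec_cat w1 w2 c2) => [c3|c3|[x'x _]]; last by rewrite x'x eqxx in xx'.
- case: (consec_cut w1 c3) => t3 [t4 [Et w3 w4 e2]].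
  by exists t3, t4, t2; rewrite Es Et catA; split => //; right.
- case: (consec_cut w2 c3) => t3 [t4 [Et w3 w4 e2]].
  by exists t1, t3, t4; rewrite Es Et; split => //; left.
Qed.

End Walks.

(** * Rerouting a broken path through a connected set *)

Section Rerouting.
Variable G : sgraph.
Variable H : {set G}.
Implicit Types (x y z a b c d u v p q : G) (s L R E P : seq G).

Definition attached x := exists2 h, h \in H & edge x h.

(** The form in which connectedness of [H] is used; [E] is nonempty, being a walk. *)
Definition linking := forall x y, attached x -> attached y ->
  exists E a b, [/\ edge x a, walk a E b, edge b y, uniq E & {subset E <= H}].

(** If [P] is duplicate-free and disjoint from [H], such a [Q] is a longer path; [perm_eq] leaves
    the order of the vertices free. *)
Definition reroutes u v P := exists Q E,
  [/\ walk u Q v, perm_eq Q (P ++ E), E != [::], uniq E & {subset E <= H}].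

Lemma reroutes_rev u v P : reroutes u v P -> reroutes v u P.
Proof.
move=> [Q [E [w p n0 uE sE]]]; exists (rev Q), E; split=> //; first exact: walk_rev.
by rewrite (perm_trans _ p) // perm_rev.
Qed.

Lemma reroutes_perm u v P P' : perm_eq P P' -> reroutes u v P -> reroutes u v P'.
Proof.
move=> pP [Q [E [w p n0 uE sE]]]; exists Q, E; split=> //.
by rewrite (perm_trans p) // perm_cat2r.
Qed.

Hypothesis linkH : linking.

Ltac perm := by apply/permP => ?; rewrite !(count_cat, count_rev) /=; clear; lia.

(* Here and below, p and q need not be adjacent: the sequence L ++ R is a path
   of G except possibly for the step from p to q, which the new walk avoids. *)
Lemma insert_consecutive u v L R p q : walk u L p -> walk q R v ->
  attached p -> attached q -> reroutes u v (L ++ R).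
Proof.
move=> wL wR ap aq; case: (linkH ap aq) => E [a [b [pa wE bq uE sE]]].
exists (L ++ E ++ R), E; split=> //; last exact: walk_neq_nil wE.
  exact: walk_cat wL pa (walk_cat wE bq wR).
perm.
Qed.

(** With the pair on [L] the route is u..x, [H], p..y backwards, q..v; with the pair on [R] it is
    u..p, [H], x..q backwards, y..v. *)
Lemma insert_attached u v L R p q x y : walk u L p -> walk q R v ->
  attached p -> attached x -> consec L x y \/ consec R x y -> edge q y ->
  reroutes u v (L ++ R).
Proof.
move=> wL wR ap ax cxy qy; case: cxy => cxy.
  case: (linkH ax ap) => E [a [b [xa wE bp uE sE]]].
  case: (consec_cut wL cxy) => L1 [L2 [-> w1 w2 _]].
  exists (L1 ++ E ++ rev L2 ++ R), E; split=> //; last exact: walk_neq_nil wE.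
    apply: walk_cat w1 xa (walk_cat wE bp (walk_cat (walk_rev w2) _ wR)).
    by rewrite edge_sym.
  perm.
case: (linkH ap ax) => E [a [b [pa wE bx uE sE]]].
case: (consec_cut wR cxy) => R1 [R2 [-> w1 w2 _]].
exists (L ++ E ++ rev R1 ++ R2), E; split=> //; last exact: walk_neq_nil wE.
  exact: walk_cat wL pa (walk_cat wE bx (walk_cat (walk_rev w1) qy w2)).
perm.
Qed.

(** For each placement of the two pairs, a route cuts both, crosses [H] between [x] and [x'], and
    joins the segments by edges from [p] and [q] to [y] and [y']. *)
Lemma insert_common u v L R p q x y x' y' : walk u L p -> walk q R v ->
  attached x -> attached x' -> x != x' ->
  consec L x y \/ consec R x y -> consec L x' y' \/ consec R x' y' ->
  edge p y -> edge q y -> edge p y' -> edge q y' ->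
  reroutes u v (L ++ R).
Proof.
move=> wL wR ax ax' xx' c c' py qy py' qy'.
have yp : edge y p by rewrite edge_sym.
have yp' : edge y' p by rewrite edge_sym.
case: (linkH ax ax') => E [a [b [xa wE bx uE sE]]].
have EN := walk_neq_nil wE.
have xb : edge x' b by rewrite edge_sym.
have ax0 : edge a x by rewrite edge_sym.
(* Pairs on different sides: u..x1, [E'], x2..q backwards, y1..p, y2..v. *)
have opposite x1 y1 x2 y2 E' a' b' : consec L x1 y1 -> consec R x2 y2 ->
    edge x1 a' -> walk a' E' b' -> edge b' x2 -> perm_eq E' E ->
    edge q y1 -> edge y1 p -> edge p y2 -> reroutes u v (L ++ R).
  move=> c1 c2 e1 wE' e2 pE e3 e4 e5.
  case: (consec_cut wL c1) => L1 [L2 [-> w1 w2 _]].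
  case: (consec_cut wR c2) => R1 [R2 [-> w3 w4 _]].
  exists (L1 ++ E' ++ rev R1 ++ L2 ++ R2), E; split=> //.
    apply: walk_cat w1 e1 (walk_cat wE' e2 (walk_cat (walk_rev w3) e3 (walk_cat w2 _ w4))).
    by [].
  by apply/permP => f; move/permP/(_ f): pE; rewrite !(count_cat, count_rev) /=; clear; lia.
case: c c' => c [] c'.
(* Both pairs on [L]: u..x, [E], x'..y backwards, p..y' backwards, q..v, or the same with the pairs
   swapped. *)
- case: (two_cuts wL c c' xx') => L1 [L2 [L3 [-> [] [w1 w2 w3 _ _]]]].
    exists (L1 ++ E ++ rev L2 ++ rev L3 ++ R), E; split=> //; last by perm.
    apply: walk_cat w1 xa (walk_cat wE bx _).
    apply: walk_cat (walk_rev w2) yp (walk_cat (walk_rev w3) _ wR).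
    by rewrite edge_sym.
  exists (L1 ++ rev E ++ rev L2 ++ rev L3 ++ R), E; split=> //; last by perm.
  apply: walk_cat w1 xb (walk_cat (walk_rev wE) ax0 _).
  apply: walk_cat (walk_rev w2) yp' (walk_cat (walk_rev w3) _ wR).
  by rewrite edge_sym.
- apply: opposite c c' xa wE bx _ qy yp py'; exact: perm_refl.
- by apply: opposite c' c xb (walk_rev wE) ax0 _ qy' yp' py; rewrite perm_rev.
(* Both pairs on [R]: u..p, y..x', [E] reversed, x..q backwards, y'..v, or the same with the pairs
   swapped. *)
- case: (two_cuts wR c c' xx') => L1 [L2 [L3 [-> [] [w1 w2 w3 _ _]]]].
    exists (L ++ L2 ++ rev E ++ rev L1 ++ L3), E; split=> //; last by perm.
    apply: walk_cat wL py (walk_cat w2 xb _).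
    exact: walk_cat (walk_rev wE) ax0 (walk_cat (walk_rev w1) qy' w3).
  exists (L ++ L2 ++ E ++ rev L1 ++ L3), E; split=> //; last by perm.
  exact: walk_cat wL py' (walk_cat w2 xa (walk_cat wE bx (walk_cat (walk_rev w1) qy w3))).
Qed.

End Rerouting.

(** * Components, connectivity, toughness and the forbidden subgraph *)

Lemma edge_connect_sym (D : sgraph) : connect_sym (@edge D).
Proof. exact: sym_connect_sym (@edge_sym D). Qed.

(** The elements of [X] lie in distinct components, so their component roots are distinct. *)
Lemma card_le_ncomp (D : sgraph) (X : {set D}) :
  {in X &, forall x y, connect edge x y -> x = y} -> #|X| <= ncomp D.
Proof.
move=> inX; have sym := @edge_connect_sym D.
have injr : {in X &, injective (fingraph.root edge)}.
  by move=> x y xX yX /eqP; rewrite root_connect // => /inX; apply.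
rewrite -(card_in_imset injr); apply: subset_leq_card; apply/subsetP=> z.
by case/imsetP=> x _ ->; rewrite !inE /= roots_root.
Qed.

Lemma ncomp_gt1P (D : sgraph) (x y : D) : ~~ connect edge x y -> 1 < ncomp D.
Proof.
move=> nxy; have xy : x != y by apply: contraNneq nxy => ->.
have -> : 2 = #|[set x; y]| by rewrite cards2 xy.
apply: card_le_ncomp => a b /set2P[] -> /set2P[] -> //.
  by move=> c; rewrite c in nxy.
by rewrite edge_connect_sym => c; rewrite c in nxy.
Qed.

Lemma complete_ncomp (G : sgraph) (S : {set G}) : complete G -> ncomp (graph_del S) <= 1.
Proof.
move=> cG; rewrite leqNgt; apply/negP => /card_gt1P[x [y [xr yr xy]]].
have sym := @edge_connect_sym (graph_del S).
move: xr yr; rewrite !inE !andbT => /eqP rx /eqP ry.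
case/eqP: (xy); rewrite -rx -ry; apply/eqP; rewrite root_connect //.
apply: connect1; move/forallP/(_ (val x))/forallP/(_ (val y))/implyP: cG; apply.
by rewrite (inj_eq val_inj).
Qed.

Lemma connectivity_le (G : sgraph) (S : {set G}) : separating S -> connectivity G <= #|S|.
Proof.
move=> sS; rewrite /connectivity.
have: S \in index_enum {set G} by rewrite mem_index_enum.
elim: (index_enum _) => [|T r IH] //; rewrite inE big_cons.
case: eqP => [<- _|_ /= /IH le]; first by rewrite sS geq_minl.
by case: ifP => // _; apply: leq_trans (geq_minr _ _) le.
Qed.

Lemma toughness_gt1 (G : sgraph) (S : {set G}) : (1%:E < toughness G)%E ->
  1 < ncomp (graph_del S) -> ncomp (graph_del S) < #|S|.
Proof.
rewrite /toughness; case: ifP => [cG _|_ tG cS].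
  by move=> cS; have := leq_trans cS (complete_ncomp S cG).
have := lt_le_trans tG (bigmin_le_cond _ _ cS).
rewrite lte_fin ltr_pdivlMr ?mul1r ?ltr_nat // ltr0n.
exact: ltn_trans cS.
Qed.

Lemma induced_P3_kP1 (G : sgraph) k (a b c : G) (K : {set G}) :
  edge a b -> edge b c -> a != c -> ~~ edge a c -> k <= #|K| ->
  {in K &, forall x y, ~~ edge x y} ->
  {in K, forall x, [&& x != a, x != b & x != c] /\ [&& ~~ edge a x, ~~ edge b x & ~~ edge c x]} ->
  induced_subgraph (graph_union (path_graph 3) (graph_copies k (path_graph 1))) G.
Proof.
move=> ab bc ac nac kK iK nK.
(* The isolated vertices go to the first [k] elements of [enum K]; the default [a] is never reached
   there since [k <= #|K|]. *)
pose f (x : graph_union (path_graph 3) (graph_copies k (path_graph 1))) : G :=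
  match x with inl i => nth a [:: a; b; c] i | inr (i, _) => nth a (enum K) i end.
have fK i o : f (inr (i, o)) \in K.
  by rewrite -mem_enum mem_nth // -cardE (leq_trans _ kK).
have ba : b != a by apply: contraTneq ab => ->; rewrite edge_irrefl.
have cb : c != b by apply: contraTneq bc => ->; rewrite edge_irrefl.
have fl i : [\/ f (inl i) = a, f (inl i) = b | f (inl i) = c].
  by case: i => [[|[|[|i]]] lti] //=; [apply: Or31|apply: Or32|apply: Or33].
have nlr i j : f (inl i) != f (inr j) /\ ~~ edge (f (inl i)) (f (inr j)).
  case: j => j o; have [/and3P[n1 n2 n3] /and3P[n4 n5 n6]] := nK _ (fK j o).
  by case: (fl i) => ->; split=> //; rewrite eq_sym.
exists f; split.
  move=> [i|[i o]] [j|[j o']] E.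
  - congr inl; apply/val_inj/eqP.
    have := nth_uniq a (ltn_ord i) (ltn_ord j) (s := [:: a; b; c]).
    move=> <-; last by rewrite /= !inE negb_or eq_sym ba ac eq_sym cb.
    by apply/eqP.
  - by have [] := nlr i (j, o'); rewrite E eqxx.
  - by have [] := nlr j (i, o); rewrite E eqxx.
  - congr inr; rewrite !ord1; congr pair; apply/val_inj/eqP.
    rewrite -(@nth_uniq _ a (enum K)) ?enum_uniq -?cardE ?(leq_trans (ltn_ord _) kK) //.
    exact/eqP.
move=> [i|[i o]] [j|[j o']].
- case: i => [[|[|[|i]]] lti] //=; case: j => [[|[|[|j]]] ltj] //=; 
  by rewrite ?(edge_irrefl, ab, bc, edge_sym b a, edge_sym c b, edge_sym c a, negbTE nac).
- by apply/negbTE; case: (nlr i (j, o')).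
- by rewrite edge_sym; apply/negbTE; case: (nlr j (i, o)).
rewrite (negbTE (iK _ _ (fK i o) (fK j o'))).
by rewrite /edge /= /copies_edge /edge /= !ord1 andbF.
Qed.

(** * A longest path and a component off it *)

Section LongestWalk.
Variables (G : sgraph) (k : nat) (u v h0 : G) (P : seq G).
Hypothesis k_ge2 : 2 <= k.
Hypothesis connG : connected_graph (2 * k + 1) G.
Hypothesis freeG : graph_free (graph_union (path_graph 3) (graph_copies k (path_graph 1))) G.
Hypothesis u_neq_v : u != v.
Hypothesis walkP : walk u P v.
Hypothesis uniqP : uniq P.
Hypothesis longestP : forall Q, walk u Q v -> uniq Q -> size Q <= size P.
Hypothesis h0P : h0 \notin P.

Definition outer : rel G := [rel a b | [&& edge a b, a \notin P & b \notin P]].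

Definition comp : {set G} := [set w | connect outer h0 w].

Lemma outer_sym : connect_sym outer.
Proof.
apply: sym_connect_sym => a b; rewrite /outer /= edge_sym.
by case: edge => //=; rewrite andbC.
Qed.

Lemma h0_comp : h0 \in comp.
Proof. by rewrite inE connect0. Qed.

Lemma comp_outside h : h \in comp -> h \notin P.
Proof.
rewrite inE => /connectP[p pp ->]; case/lastP: p pp => // p x.
by rewrite rcons_path last_rcons => /andP[_ /and3P[]].
Qed.

Lemma comp_closed h x : h \in comp -> edge h x -> x \notin P -> x \in comp.
Proof.
move=> hH hx xP; move: (hH); rewrite !inE => /connect_trans; apply.
by apply: connect1; rewrite /outer /= hx xP comp_outside.
Qed.

Lemma comp_linking : linking comp.
Proof.
move=> x y [a aH xa] [b bH yb].
have: connect outer a b.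
  by move: aH bH; rewrite !inE outer_sym; apply: connect_trans.
case/connectP=> p0 pp0; case/shortenP: pp0 => p pp up _ Eb.
have sub : subrel outer edge by move=> c d /and3P[].
exists (a :: p), a, b; split=> //.
- by rewrite Eb; apply: path_walk; apply: sub_path pp.
- by rewrite edge_sym.
move=> c; rewrite inE => /predU1P[->//|cp].
case/splitPr: cp pp => p1 p2; rewrite cat_path /= => /and3P[pp1 lc _].
have: connect outer a c.
  apply/connectP; exists (rcons p1 c); last by rewrite last_rcons.
  by rewrite rcons_path pp1.
by move: aH; rewrite !inE; apply: connect_trans.
Qed.

(** [comp] misses [P], so the rerouted walk would be a path longer than [P]. *)
Lemma no_reroute : ~ reroutes comp u v P.
Proof.
move=> [Q [E [wQ pQ EN uE sE]]].
have uQ : uniq Q.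
  rewrite (perm_uniq pQ) cat_uniq uniqP uE andbT /=.
  by apply/hasPn => x /sE /comp_outside.
have := longestP wQ uQ; rewrite (perm_size pQ) size_cat.
by case: E EN {pQ uE sE} => //= e E _; clear; lia.
Qed.

(** * Neighbors of the component and their successors *)

Definition att : {set G} := [set x in P | [exists h in comp, edge x h]].

Lemma att_attached x : x \in att -> attached comp x.
Proof. by rewrite inE => /andP[_ /exists_inP[h hH xh]]; exists h. Qed.

Lemma att_on x : x \in att -> x \in P.
Proof. by rewrite inE => /andP[]. Qed.

Lemma comp_nbr h x : h \in comp -> edge h x -> x \in P -> x \in att.
Proof.
move=> hH hx xP; rewrite inE xP /=.
by apply/exists_inP; exists h => //; rewrite edge_sym.
Qed.

(* [succ] has the junk value x at the last vertex x = v. *)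
Definition succ x := nth x P (index x P).+1.

Lemma consecE x y : consec P x y -> y = succ x.
Proof.
move=> [s1 [s2 E]]; rewrite /succ E.
have xs1 : x \notin s1.
  by move: uniqP; rewrite E cat_uniq /= negb_or => /and3P[_ /andP[/negbTE-> _] _].
rewrite index_cat (negbTE xs1) /= eqxx addn0 nth_cat ltnNge leqnSn /=.
by rewrite subSnn.
Qed.

Lemma consec_succ x : x \in P -> x != v -> consec P x (succ x).
Proof.
by move=> xP xv; case: (consec_exists walkP xP xv) => y c; rewrite -(consecE c).
Qed.

Lemma succ_inj (X : {set G}) : {subset X <= P} -> #|succ @: (X :\ v)| = #|X :\ v|.
Proof.
move=> XP; apply: card_in_imset => x y /setD1P[xv /XP xP] /setD1P[yv /XP yP] E.
apply: (consec_uniql uniqP (consec_succ xP xv)).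
by rewrite E; apply: consec_succ.
Qed.

Definition succs := succ @: (att :\ v).

Lemma succsP y : y \in succs -> exists2 x, x \in att & consec P x y.
Proof.
case/imsetP=> x /setD1P[xv xA] ->; exists x => //.
exact: consec_succ (att_on xA) xv.
Qed.

Lemma succs_on y : y \in succs -> y \in P.
Proof. by case/succsP=> x _ /consec_mem[]. Qed.

(** Otherwise a path through [comp] could be inserted between [x] and [y]. *)
Lemma consec_notin_att x y : consec P x y -> x \in att -> y \notin att.
Proof.
move=> c xA; apply/negP => yA; apply: no_reroute.
case: (consec_cut walkP c) => P1 [P2 [-> w1 w2 _]].
exact (insert_consecutive comp_linking w1 w2 (att_attached xA) (att_attached yA)).
Qed.

Lemma succs_notin_att y : y \in succs -> y \notin att.
Proof. by case/succsP=> x xA c; apply: consec_notin_att c xA. Qed.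

Lemma comp_succs_nonadj h y : h \in comp -> y \in succs -> ~~ edge h y.
Proof.
move=> hH yJ; apply: contra (succs_notin_att yJ) => hy; exact: comp_nbr hH hy (succs_on yJ).
Qed.

(** Which of [y] and [y'] comes first is left open, since the uses below are symmetric in them. *)
Lemma succs_cut y y' : y \in succs -> y' \in succs -> y != y' -> exists x x' P1 P2 P3,
  [/\ x \in att, x' \in att, P = P1 ++ P2 ++ P3, walk u P1 x &
   walk y P2 x' /\ walk y' P3 v \/ walk y' P2 x' /\ walk y P3 v].
Proof.
case/succsP=> x xA c /succsP[x' x'A c'] yy'.
have xx' : x != x' by apply: contra_neq yy' => E; apply: (consec_uniqr uniqP c); rewrite E.
case: (two_cuts walkP c c' xx') => P1 [P2 [P3 [E [] [w1 w2 w3 _ _]]]].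
  by exists x, x', P1, P2, P3; split=> //; left.
by exists x', x, P1, P2, P3; split=> //; right.
Qed.

(** With [y y'] an edge, [P2] reversed could be followed by [P3], and the break between [x] and [x']
    bridged through [comp]. *)
Lemma succs_indep y y' : y \in succs -> y' \in succs -> ~~ edge y y'.
Proof.
move=> yJ y'J; apply/negP => e.
have yy' : y != y' by apply: contraTneq e => ->; rewrite edge_irrefl.
case: (succs_cut yJ y'J yy') => x [x' [P1 [P2 [P3 [xA x'A E w1 w23]]]]].
have [z [z' [zz' [w2 w3]]]] : exists z z', edge z z' /\ (walk z P2 x' /\ walk z' P3 v).
  by case: w23 => w; [exists y, y'|exists y', y; rewrite edge_sym].
apply: no_reroute; rewrite E.
apply: (@reroutes_perm _ _ _ _ (P1 ++ rev P2 ++ P3)).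
  by rewrite perm_cat2l perm_cat2r perm_rev.
have w23' := walk_cat (walk_rev w2) zz' w3.
exact (insert_consecutive comp_linking w1 w23' (att_attached xA) (att_attached x'A)).
Qed.

(** Otherwise [P2] is reversed, [w] joins it to [P3], and [comp] bridges [x] and [x']: a longer
    path. *)
Lemma outside_succs w y y' : w \notin P -> w \notin comp -> y \in succs -> y' \in succs ->
  y != y' -> edge w y -> ~~ edge w y'.
Proof.
move=> wP wH yJ y'J yy' wy; apply/negP => wy'.
case: (succs_cut yJ y'J yy') => x [x' [P1 [P2 [P3 [xA x'A E w1 w23]]]]].
have [z [z' [wz wz' w2 w3]]] : exists z z', [/\ edge w z, edge w z', walk z P2 x' & walk z' P3 v].
  by case: w23 => -[w2 w3]; [exists y, y'|exists y', y].
case: (comp_linking (att_attached xA) (att_attached x'A)) => F [a [b [xa wF bx uF sF]]].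
have wQ : walk u (P1 ++ F ++ rev P2 ++ [:: w] ++ P3) v.
  apply: walk_cat w1 xa (walk_cat wF bx (walk_cat (walk_rev w2) _ (walk_cat (walk1 w) wz' w3))).
  by rewrite edge_sym.
have pQ : perm_eq (P1 ++ F ++ rev P2 ++ [:: w] ++ P3) (P ++ w :: F).
  by rewrite E; apply/permP => f; rewrite !(count_cat, count_rev) /=; clear; lia.
have uQ : uniq (P1 ++ F ++ rev P2 ++ [:: w] ++ P3).
  rewrite (perm_uniq pQ) cat_uniq uniqP /= uF negb_or wP andbT /= .
  apply/andP; split; first by apply/hasPn => z0 /sF /comp_outside.
  by apply: contra wH => /sF.
by have := longestP wQ uQ; rewrite (perm_size pQ) size_cat /=; clear; lia.
Qed.

(** A neighbor of [comp] is in [comp] or in [att], so deleting [att] cuts [h0] off from the rest of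
    [P], which is not empty. *)
Lemma card_att : 2 * k + 1 <= #|att|.
Proof.
apply: leq_trans connG _; apply: connectivity_le; apply/orP; left.
(* [u] and its successor are not both in [att]. *)
have [z zP zA] : exists2 z, z \in P & z \notin att.
  have uP := walk_start walkP.
  case: (boolP (u \in att)) => uA; last by exists u.
  have c := consec_succ uP u_neq_v.
  by exists (succ u); [case: (consec_mem c)|apply: consec_notin_att c uA].
have h0A : h0 \notin att by apply: contra h0P; apply: att_on.
apply: (@ncomp_gt1P (graph_del att) (Sub h0 h0A) (Sub z zA)).
apply/connectP => -[p pp lp].
have: z = val (last (Sub h0 h0A : graph_del att) p) by rewrite -lp.
have: all (fun w => val w \in comp) p.
  have : val (Sub h0 h0A : graph_del att) \in comp := h0_comp.
  elim: p {lp} (Sub h0 h0A : graph_del att) pp => //= w p IH h /andP[hw pp] hH.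
  have wH : val w \in comp.
    apply: (comp_closed hH) => //; apply: contra (valP w) => wP; exact: comp_nbr hH hw wP.
  by rewrite wH; apply: IH pp wH.
case/lastP: p {pp lp} => [_ /= E|p w].
  by case/negP: h0P; rewrite -E.
rewrite all_rcons last_rcons => /andP[/comp_outside + _] E.
by rewrite -E zP.
Qed.

(** One element is lost if [v] is in [att], for it has no successor. *)
Lemma card_succs : 2 * k <= #|succs|.
Proof.
rewrite succ_inj; last exact: att_on.
by have := card_att; have := cardsD1 v att; case: (v \in att); clear; lia.
Qed.

(** * Heavy and light vertices *)

Definition nbrs (X : {set G}) w := [set y in X | edge w y].
Definition probe h := h |: succs.

Lemma comp_notin_succs h : h \in comp -> h \notin succs.
Proof. by move=> /comp_outside; apply: contra; apply: succs_on. Qed.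

Lemma card_probe h : h \in comp -> 2 * k + 1 <= #|probe h|.
Proof.
move=> /comp_notin_succs hJ; rewrite /probe cardsU1 hJ.
by have := card_succs; clear; lia.
Qed.

Lemma probe_indep h : h \in comp -> {in probe h &, forall x y, ~~ edge x y}.
Proof.
move=> hH x y /setU1P[->|xJ] /setU1P[->|yJ].
- by rewrite edge_irrefl.
- exact: comp_succs_nonadj.
- by rewrite edge_sym; apply: comp_succs_nonadj.
- exact: succs_indep.
Qed.

(** Two neighbors with [w] between them induce a P_3; [k] nonneighbors of [w] in [probe h] would
    complete the forbidden subgraph. *)
Lemma card_nbrs_probe h w : h \in comp -> 1 < #|nbrs (probe h) w| ->
  #|probe h| < #|nbrs (probe h) w| + k.
Proof.
move=> hH /card_gt1P[a [b [aN bN ab]]]; rewrite ltnNge; apply/negP => le.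
apply: freeG; case/setIdP: aN bN => aI wa /setIdP[bI wb].
have aw : edge a w by rewrite edge_sym.
apply: (induced_P3_kP1 (K := probe h :\: nbrs (probe h) w) aw wb ab).
- exact: probe_indep hH _ _ aI bI.
- rewrite cardsDS; first lia.
  by apply/subsetP=> x; rewrite inE => /andP[].
- by move=> x y /setDP[xI _] /setDP[yI _]; apply: probe_indep hH _ _ xI yI.
move=> x /setDP[xI]; rewrite inE xI => wx.
split; apply/and3P; split => //.
- by apply: contraNneq wx => ->.
- by apply: contraTneq wa => <-; apply: probe_indep hH _ _ xI aI.
- by apply: contraNneq wx => ->.
- exact: probe_indep hH _ _ aI xI.
- exact: probe_indep hH _ _ bI xI.
Qed.

(** Counting in [succs] rather than in [probe h] keeps the set independent of [h]. *)
Definition heavy := [set w | 1 < #|nbrs succs w|].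

Lemma card_nbrs_probeE h w : h \in comp -> #|nbrs (probe h) w| = edge w h + #|nbrs succs w|.
Proof.
move=> hH; rewrite (cardsD1 h) !inE eqxx /=; congr (_ + _).
apply: eq_card => x; rewrite !inE; case: eqP => [->|_] //=.
by rewrite (negbTE (comp_notin_succs hH)).
Qed.

Lemma card_nbrs_heavy h s : h \in comp -> s \in heavy -> #|probe h| < #|nbrs (probe h) s| + k.
Proof.
move=> hH; rewrite inE => sS; apply: card_nbrs_probe => //.
by rewrite card_nbrs_probeE //; apply: leq_trans sS (leq_addl _ _).
Qed.

(** Adding [h] gives at most two neighbors; if there were two, [card_nbrs_probe] would leave
    [probe h] fewer than k + 2 elements, against 2k + 1. *)
Lemma card_nbrs_light h w : h \in comp -> w \notin heavy -> #|nbrs (probe h) w| <= 1.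
Proof.
move=> hH; rewrite inE -leqNgt => le; rewrite leqNgt; apply/negP => /(card_nbrs_probe hH).
by move: le; have := card_probe hH; rewrite card_nbrs_probeE //; move: k_ge2; case: edge => /=; clear; lia.
Qed.

Lemma card_common h s t : h \in comp -> s \in heavy -> t \in heavy ->
  2 < (edge s h && edge t h) + #|nbrs succs s :&: nbrs succs t|.
Proof.
move=> hH sS tS; have := card_nbrs_heavy hH sS; have := card_nbrs_heavy hH tS.
have := card_probe hH; have := cardsUI (nbrs (probe h) s) (nbrs (probe h) t).
have : #|nbrs (probe h) s :|: nbrs (probe h) t| <= #|probe h|.
  by apply: subset_leq_card; apply/subsetP => x; rewrite !inE => /orP[] /andP[].
have -> : #|nbrs (probe h) s :&: nbrs (probe h) t| = (edge s h && edge t h) + #|nbrs succs s :&: nbrs succs t|.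
  rewrite (cardsD1 h) !inE eqxx /=; congr (_ + _).
  apply: eq_card => x; rewrite !inE; case: eqP => [->|_] //=.
  by rewrite (negbTE (comp_notin_succs hH)).
by clear; lia.
Qed.

(** A neighbor [h] in [comp] and the successor of [x] are two neighbors in [probe h], too many for a
    light vertex. *)
Lemma att_heavy x : x \in att -> x != v -> x \in heavy.
Proof.
move=> xA xv; case: (att_attached xA) => h hH xh.
apply: contraT => /(card_nbrs_light hH); rewrite card_nbrs_probeE // xh.
have c := consec_succ (att_on xA) xv.
have: 0 < #|nbrs succs x|.
  apply/card_gt0P; exists (succ x); rewrite inE.
  case: (consec_cut walkP c) => _ [_ [_ _ _ ->]].
  by rewrite andbT; apply: imset_f; apply/setD1P.
by case: #|nbrs succs x|.
Qed.

Lemma heavy_on s : s \in heavy -> s \in P.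
Proof.
rewrite inE => /card_gt1P[y [y' [+ + yy']]]; rewrite !inE => /andP[yJ sy] /andP[y'J sy'].
apply: contraT => sP; case: (boolP (s \in comp)) => sH.
  by rewrite (negbTE (comp_succs_nonadj sH yJ)) in sy.
by rewrite (negbTE (outside_succs sP sH yJ y'J yy' sy)) in sy'.
Qed.

(** * Successors of the heavy vertices *)

Lemma consec_neq y y' x x' : consec P x y -> consec P x' y' -> y != y' -> x != x'.
Proof. by move=> c c'; apply: contra_neq => E; apply: (consec_uniqr uniqP c); rewrite E. Qed.

(** If [s'] were heavy, at least two common neighbors of [s] and [s'] would lie in [succs], and
    [insert_common] would apply to [P] cut between [s] and [s']. *)
Lemma heavy_succ s s' : s \in heavy -> consec P s s' -> s' \notin heavy.
Proof.
move=> sS c; apply/negP => s'S.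
have := card_common h0_comp sS s'S.
have [/card_gt1P[y [y' [+ + yy']]] _|] := ltnP 1 #|nbrs succs s :&: nbrs succs s'|; last first.
  by case: (_ && _) => /=; clear; lia.
rewrite !inE => /andP[/andP[yJ sy] /andP[_ s'y]] /andP[/andP[y'J sy'] /andP[_ s'y']].
case: (consec_cut walkP c) => L [R [E wL wR _]].
(* The predecessor of [z] is not [s]: otherwise [s'] would be in [succs], which is independent, and
   could not be heavy. *)
have loc z : z \in succs -> exists x, [/\ x \in att, consec P x z & consec L x z \/ consec R x z].
  move=> zJ; case: (succsP zJ) => x xA cx; exists x; split=> //.
  move: cx; rewrite E => cx; case: (consec_cat wL wR cx); [by left|by right|].
  move=> [_ zs]; move: s'S; rewrite -zs inE => /card_gt1P[a [_ [+ _ _]]].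
  by case/setIdP=> aJ; rewrite (negbTE (succs_indep zJ aJ)).
case: (loc y yJ) => x [xA cx lx]; case: (loc y' y'J) => x' [x'A cx' lx'].
apply: no_reroute; rewrite E.
by apply: (insert_common comp_linking wL wR (att_attached xA) (att_attached x'A) _ lx lx') => //;
  apply: consec_neq cx cx' yy'.
Qed.

(* If s' and t' were adjacent, P1 followed by (rev P2 ++ P3) would be a path but
   for its step from s to t, and so would (rev P3 ++ P2) followed by rev P1 but
   for its step from t to s.  The edges of P1 and P3 keep their direction in the
   former, those of P2 in the latter; among three common neighbors of s and t,
   two can thus be inserted in the same one. *)
Lemma heavy_succ_segments s s' t t' P1 P2 P3 : P = P1 ++ P2 ++ P3 ->
  walk u P1 s -> walk s' P2 t -> walk t' P3 v -> edge t t' ->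
  s \in heavy -> t \in heavy -> ~~ edge s' t'.
Proof.
move=> E w1 w2 w3 tt' sS tS; apply/negP => s't'.
pose L := P1; pose R := rev P2 ++ P3; pose L' := rev P3 ++ P2; pose R' := rev P1.
have wR : walk t R v by apply: walk_cat (walk_rev w2) s't' w3.
have wL' : walk v L' t by apply: walk_cat (walk_rev w3) _ w2; rewrite edge_sym.
have wR' : walk s R' u by apply: walk_rev.
have noR : ~ reroutes comp u v (L ++ R).
  move=> r; apply: no_reroute; apply: reroutes_perm r.
  by rewrite E perm_cat2l perm_cat2r perm_rev.
have noR' : ~ reroutes comp v u (L' ++ R').
  move=> r; apply: no_reroute; apply: reroutes_rev; apply: reroutes_perm r.
  by rewrite E; apply/permP => f; rewrite !(count_cat, count_rev); clear; lia.
set C := nbrs succs s :&: nbrs succs t.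
have CP y : y \in C -> [/\ y \in succs, edge s y & edge t y].
  by rewrite !inE => /andP[/andP[-> ->] /andP[_ ->]].
(* If [h0] is adjacent to both [s] and [t], it bridges the gap itself; otherwise all three common
   neighbors are in [succs]. *)
have C3 : 2 < #|C|.
  have := card_common h0_comp sS tS; case: (boolP (edge s h0 && edge t h0)) => // /andP[sh th] _.
  case: noR; exists (L ++ [:: h0] ++ R), [:: h0]; split=> //.
  - by apply: walk_cat w1 sh (walk_cat (walk1 h0) _ wR); rewrite edge_sym.
  - by apply/permP => f; rewrite !count_cat; clear; lia.
  - by move=> x; rewrite inE => /eqP->; apply: h0_comp.
pose outerseg y := exists x, [/\ x \in att, consec P x y & consec L x y \/ consec R x y].
pose innerseg y := exists x, [/\ x \in att, consec P x y & consec L' x y].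
(* The step into [y] lies in [P1] or [P3], in [P2], or is one of the two joints. *)
have loc y : y \in C -> [\/ outerseg y, innerseg y, s \in att /\ y = s' | t \in att /\ y = t'].
  case/CP=> yJ _ _; case: (succsP yJ) => x xA c.
  move: (c); rewrite E => c'; case: (consec_cat w1 (walk_cat w2 tt' w3) c') => {}c'.
  - by apply: Or41; exists x; split=> //; left.
  - case: (consec_cat w2 w3 c') => {}c'.
    + by apply: Or42; exists x; split=> //; apply: consec_catr.
    + by apply: Or41; exists x; split=> //; right; apply: consec_catr.
    + by apply: Or44; case: c' => <- ->.
  - by apply: Or43; case: c' => <- ->.
have outer2 y y' : y \in C -> y' \in C -> outerseg y -> outerseg y' -> y = y'.
  move=> /CP[_ sy ty] /CP[_ sy' ty'] [x [xA c l]] [x' [x'A c' l']].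
  apply/eqP; apply: contraT => yy'; case: noR.
  exact: (insert_common comp_linking w1 wR (att_attached xA) (att_attached x'A)
    (consec_neq c c' yy') l l').
have inner2 y y' : y \in C -> y' \in C -> innerseg y -> innerseg y' -> y = y'.
  move=> /CP[_ sy ty] /CP[_ sy' ty'] [x [xA c l]] [x' [x'A c' l']].
  apply/eqP; apply: contraT => yy'; case: noR'.
  by apply: (insert_common comp_linking wL' wR' (att_attached xA) (att_attached x'A)
    (consec_neq c c' yy') _ _ ty sy ty' sy'); left.
have outerA y : s \in att -> y \in C -> outerseg y -> False.
  move=> sA /CP[_ _ ty] [x [xA _ l]]; apply: noR.
  exact: (insert_attached comp_linking w1 wR (att_attached sA) (att_attached xA) l ty).
have innerA y : t \in att -> y \in C -> innerseg y -> False.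
  move=> tA /CP[_ sy _] [x [xA _ l]]; apply: noR'.
  by apply: (insert_attached comp_linking wL' wR' (att_attached tA) (att_attached xA) _ sy); left.
have s't'C : s' \in C -> t' \in C -> False.
  by move=> /CP[s'J _ _] /CP[t'J _ _]; move: (succs_indep s'J t'J); rewrite s't'.
have nodup y y' z : y != y' -> y = z -> y' = z -> False.
  by move=> /eqP n e e'; case: n; rewrite e e'.
have n2 y y' : y != y' -> y \in C -> y' \in C -> outerseg y -> outerseg y' -> False.
  by move=> /eqP n yC y'C a b; apply: n; apply: outer2.
have n3 y y' : y != y' -> y \in C -> y' \in C -> innerseg y -> innerseg y' -> False.
  by move=> /eqP n yC y'C a b; apply: n; apply: inner2.
(* [C] has at most one outer and one inner element; [s'] excludes [t'] and the outer one, [t']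
   excludes the inner one. So two elements at most. *)
case/card_gt2P: C3 => y1 [y2 [y3 [[i1 i2 i3] [n12 n23 n31]]]].
case: (loc y1 i1) => [o1|o1|[a1 o1]|[a1 o1]];
  case: (loc y2 i2) => [o2|o2|[a2 o2]|[a2 o2]];
  first [ exact: n2 n12 i1 i2 o1 o2 | exact: n3 n12 i1 i2 o1 o2 | exact: nodup n12 o1 o2
        | by apply: s't'C; rewrite -?o1 -?o2
        | exact: outerA a1 i2 o2 | exact: outerA a2 i1 o1
        | exact: innerA a1 i2 o2 | exact: innerA a2 i1 o1 | idtac ];
  case: (loc y3 i3) => [o3|o3|[a3 o3]|[a3 o3]];
  first [ exact: n2 n31 i3 i1 o3 o1 | exact: n3 n31 i3 i1 o3 o1 | exact: nodup n31 o3 o1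
        | exact: n2 n23 i2 i3 o2 o3 | exact: n3 n23 i2 i3 o2 o3 | exact: nodup n23 o2 o3
        | by apply: s't'C; rewrite -?o1 -?o2 -?o3
        | exact: outerA a1 i3 o3 | exact: outerA a2 i3 o3 | exact: outerA a3 i1 o1
        | exact: outerA a3 i2 o2
        | exact: innerA a1 i3 o3 | exact: innerA a2 i3 o3 | exact: innerA a3 i1 o1
        | exact: innerA a3 i2 o2 ].
Qed.

Lemma heavy_succ_indep s t s' t' : s \in heavy -> t \in heavy -> s != t ->
  consec P s s' -> consec P t t' -> ~~ edge s' t'.
Proof.
move=> sS tS st c c'; case: (two_cuts walkP c c' st) => P1 [P2 [P3 [E [] [w1 w2 w3 e e']]]].
  exact: heavy_succ_segments E w1 w2 w3 e' sS tS.
by rewrite edge_sym; apply: heavy_succ_segments E w1 w2 w3 e tS sS.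
Qed.

(** * Components left by deleting the heavy vertices *)

Lemma light_trans x y z : x \notin heavy -> y \notin heavy -> z \notin heavy ->
  edge x y -> edge y z -> x != z -> edge x z.
Proof.
move=> xS yS zS xy yz xz; apply: contraT => nxz; case: freeG.
(* A light [w] equals or meets at most one element of [probe h0]; if it belongs to [probe h0],
   independence leaves only itself. *)
pose T w := [set a in probe h0 | (a == w) || edge w a].
have cT w : w \notin heavy -> #|T w| <= 1.
  move=> wS; case: (boolP (w \in probe h0)) => wI.
    rewrite -(cards1 w); apply: subset_leq_card; apply/subsetP => a /setIdP[aI].
    by rewrite (negbTE (probe_indep h0_comp wI aI)) orbF inE.
  apply: leq_trans (card_nbrs_light h0_comp wS); apply: subset_leq_card.
  apply/subsetP => a /setIdP[aI]; case: eqP => [aw|_ wa]; first by rewrite -aw aI in wI.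
  by apply/setIdP.
(* At most three of at least 2k + 1 elements are removed, and 2k - 2 is at least [k]. *)
apply: (induced_P3_kP1 (K := probe h0 :\: (T x :|: T y :|: T z)) xy yz xz nxz).
- have := cT x xS; have := cT y yS; have := cT z zS; have := card_probe h0_comp.
  have := cardsID (T x :|: T y :|: T z) (probe h0).
  have : #|probe h0 :&: (T x :|: T y :|: T z)| <= #|T x| + #|T y| + #|T z|.
    apply: leq_trans (subset_leq_card (subsetIr _ _)) _.
    apply: leq_trans (leq_card_setU _ _) _; rewrite leq_add2r.
    exact: leq_card_setU.
  by move: k_ge2; clear; lia.
- by move=> a b /setDP[aI _] /setDP[bI _]; apply: probe_indep h0_comp _ _ aI bI.
move=> a /setDP[aI].
have inT w : (a \in T w) = (a == w) || edge w a by rewrite [LHS]inE aI.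
rewrite !in_setU !inT !negb_or.
by case/andP=> [/andP[/andP[-> ->] /andP[-> ->]] /andP[-> ->]].
Qed.

(** By [light_trans], a path shortens to a single edge. *)
Lemma connect_light (x y : graph_del heavy) : connect edge x y -> x = y \/ edge (val x) (val y).
Proof.
case/connectP=> p; elim/last_ind: p y => [|p z IH] y; first by move=> _ ->; left.
rewrite rcons_path last_rcons => /andP[pp lz] ->.
case: (IH _ pp (erefl _)) => [->|e]; first by right.
case: (eqVneq x z) => [->|xz]; first by left.
right; apply: (@light_trans (val x) (val (last x p)) (val z)) e lz _.
- exact: (valP x).
- exact: (valP (last x p)).
- exact: (valP z).
by apply: contra_neq xz => /val_inj.
Qed.

(* When v is heavy, it has no successor and the component of h0 makes up for it;
   when v is not heavy it may belong to that component, and it is not needed. *)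
Lemma heavy_many_components :
  exists2 S0 : {set G}, 1 < ncomp (graph_del S0) & #|S0| <= ncomp (graph_del S0).
Proof.
have SP : {subset heavy <= P} by move=> s; apply: heavy_on.
have SS : {in succ @: (heavy :\ v), forall y, exists s, [/\ s \in heavy, consec P s y & y = succ s]}.
  move=> y /imsetP[s /setD1P[sv sS] ->]; exists s; split=> //.
  exact: consec_succ (SP _ sS) sv.
pose X := succ @: (heavy :\ v) :|: (if v \in heavy then [set h0] else set0).
have XP y : y \in X -> y \in succ @: (heavy :\ v) \/ v \in heavy /\ y = h0.
  rewrite inE => /orP[->|]; first by left.
  by case: ifP => [vS /set1P->|_]; [right | rewrite inE].
have h0S : h0 \notin heavy by apply: contra h0P => /SP.
have XS y : y \in X -> y \notin heavy.
  by case/XP=> [/SS[s [sS c _]]|[_ ->]] //; apply: heavy_succ sS c.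
(* If adjacent to [h0], [y] would be in [att], hence heavy unless it is [v]; but [v] is heavy and
   [y] is not. *)
have h0X y : v \in heavy -> y \in succ @: (heavy :\ v) -> ~~ edge h0 y.
  move=> vS yX; have yS : y \notin heavy by apply: XS; rewrite inE yX.
  case/SS: yX => s [sS c _]; apply: contra (yS) => h0y.
  apply: att_heavy; first by apply: comp_nbr h0_comp h0y _; case: (consec_mem c).
  by apply: contraNneq yS => ->.
have Xindep : {in X &, forall y y', ~~ edge y y'}.
  move=> y y' /XP[yX|[vS ->]] /XP[y'X|[vS' ->]].
  - case/SS: yX => s [sS c Ey]; case/SS: y'X => s' [s'S c' Ey'].
    case: (eqVneq s s') => [ss'|ss']; first by rewrite Ey Ey' ss' edge_irrefl.
    exact: heavy_succ_indep sS s'S ss' c c'.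
  - by rewrite edge_sym h0X.
  - exact: h0X.
  - by rewrite edge_irrefl.
have cX : #|heavy| <= #|X|.
  rewrite (cardsD1 v heavy) -(succ_inj SP) /X; case: ifP => vS; last by rewrite setU0.
  rewrite setUC cardsU1; case: (boolP (h0 \in _)) => //= /SS[s [_ /consec_mem[_ +] _]].
  by rewrite (negbTE h0P).
have SN : #|heavy| <= ncomp (graph_del heavy).
  apply: leq_trans cX _.
  have -> : #|X| = #|[set x : graph_del heavy | val x \in X]|.
    rewrite -(card_imset _ val_inj); apply: eq_card => x; apply/idP/imsetP.
      by move=> xX; exists (exist _ x (XS _ xX) : graph_del heavy) => //; rewrite in_set.
    by case=> y; rewrite in_set => yX ->.
  apply: card_le_ncomp => x y; rewrite in_set => xX; rewrite in_set => yX /connect_light[] // e.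
  by rewrite (negbTE (Xindep _ _ xX yX)) in e.
exists heavy => //; apply: leq_trans SN.
(* [heavy] has at least 2k elements, so more than one component is left. *)
have : att :\ v \subset heavy by apply/subsetP=> x /setD1P[xv xA]; apply: att_heavy.
move/subset_leq_card; apply: leq_trans.
by have := card_att; have := cardsD1 v att; move: k_ge2; case: (v \in att) => /=; clear; lia.
Qed.

End LongestWalk.

(** * Existence of a longest path, and the conclusion *)

Lemma longest_walk (G : sgraph) (u v : G) : connect edge u v ->
  exists P, [/\ walk u P v, uniq P & forall Q, walk u Q v -> uniq Q -> size Q <= size P].
Proof.
(* [n] counts edges, since [u] is kept out of the tuple. *)
pose walks n := [exists t : n.-tuple G, [&& path edge u t, last u t == v & uniq (u :: t)]].
case/connectP=> p0 pp0; case/shortenP: pp0 => p pp up _ lp.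
have ex : exists n, walks n.
  by exists (size p); apply/existsP; exists (in_tuple p); rewrite pp -lp eqxx up.
have bound n : walks n -> n <= #|G|.
  case/existsP=> t /and3P[_ _ /= /andP[_ /card_uniqP ct]].
  by rewrite -(size_tuple t) -ct max_card.
case: (ex_maxnP ex bound) => n /existsP[t /and3P[pt /eqP lt ut]] maxn.
exists (u :: t); split=> //; first by rewrite -lt; apply: path_walk.
move=> Q wQ uQ; case/walk_path: (wQ) uQ => q -> [pq lq] uq.
rewrite /= size_tuple ltnS; apply: maxn; apply/existsP; exists (in_tuple q).
by rewrite pq lq eqxx uq.
Qed.

(** Otherwise the empty set is separating and the connectivity is 0. *)
Lemma connected_connect (G : sgraph) (u v : G) : connected_graph 1 G -> connect edge u v.
Proof.
move=> cG.
have n0 (x : G) : x \notin set0 by rewrite inE.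
have lift (x y : @graph_del G set0) : connect edge x y -> connect edge (val x) (val y).
  case/connectP=> p; elim: p x => [|z p IH] x /=; first by move=> _ ->.
  case/andP=> xz pp lp; apply: connect_trans (IH _ pp lp).
  exact: (@connect1 _ edge (val x) (val z) xz).
apply: (lift (Sub u (n0 u)) (Sub v (n0 v))).
apply: contraT => /ncomp_gt1P c1.
have /connectivity_le : @separating G set0 by rewrite /separating c1.
by rewrite cards0 leqNgt cG.
Qed.

Theorem theorem1p2 (k : nat) (G : sgraph) (hk : 2 <= k)
  (hconn : connected_graph (2 * k + 1) G)
  (hfree : graph_free (graph_union (path_graph 3) (graph_copies k (path_graph 1))) G)
  (htough : (1%:E < toughness G)%E) :
  hamiltonian_connected G.
Proof.
move=> u v uv.
have cuv : connect edge u v.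
  by apply: connected_connect; apply: leq_trans hconn; rewrite addn1.
case: (longest_walk cuv) => P [wP uP longP].
case: (walk_path wP) => p EP [pp lp]; exists p; split; rewrite -?EP // => x.
apply: contraT => xP.
have [S c1 leS] := heavy_many_components hk hconn hfree uv wP uP longP xP.
by have := toughness_gt1 htough c1; rewrite ltnNge leS.
Qed.
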